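(* Let $n \ge 2$ be an integer and let $L$ be a chain lattice with $n$ elements. Then there exists an algebraic representation $\mathbf{A} = (A, F)$ of $L$ such that $A$ has $n$ elements and $F$ consists of $n-1$ functions.
   Context: An algebraic structure is a pair $\mathbf{A} = (A, F)$ where $A$ is a set and $F$ is a set of functions (operations), each of the form $f : A^m \to A$ for some $m \in \mathbb{N} \cup \{0\}$ (the arity $m$ may depend on $f$; a nullary operation, $m=0$, is a distinguished constant in $A$). A subalgebra of $\mathbf{A}$ is a subset $B \subseteq A$ closed under every operation in $F$ (in particular containing every nullary constant), with the restricted operations. The subalgebras of $\mathbf{A}$, ordered by set inclusion, form a lattice $\mathbf{Sub}(\mathbf{A})$. An algebraic representation of a lattice $L$ is an algebraic structure $\mathbf{A}$ such that $\mathbf{Sub}(\mathbf{A})$ is isomorphic to $L$ as a lattice. A chain lattice with $n$ elements is a lattice whose set of $n$ elements is totally ordered. *)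

(* Defs.v *)
From HB Require Import structures.
From mathcomp Require Import all_boot all_order.
From mathcomp Require Import boolp classical_sets functions cardinality.

Set Implicit Arguments.
Unset Strict Implicit.
Unset Printing Implicit Defensive.

Import Order.Theory.
Local Open Scope classical_set_scope.
Local Open Scope card_scope.

(* An operation packs its arity, so equality of operations is equality of     *)
(* arity and of function; an operation of arity 0 amounts to a constant.      *)
Definition operation (T : Type) := {m : nat & m.-tuple T -> T}.

Record algebra := Algebra {
  carrier :> Type;
  ops : set (operation carrier)
}.
Arguments ops : clear implicits.

(* For an operation of arity 0 the premise on the arguments is void, so that  *)
(* B must contain all the constants; set0 is a subalgebra when there is none. *)
Definition is_subalgebra (A : algebra) (B : set A) : Prop :=
  forall (m : nat) (f : m.-tuple A -> A),
    ops A (existT _ m f) ->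
    forall t : m.-tuple A, (forall i : 'I_m, B (tnth t i)) -> B (f t).

Lemma is_subalgebraI (A : algebra) (B C : set A) :
  is_subalgebra B -> is_subalgebra C -> is_subalgebra (B `&` C).
Proof.
move=> Bsub Csub m f fA t tBC.
by split; [apply: (Bsub m) | apply: (Csub m)] => // i; have [] := tBC i.
Qed.

Lemma is_subalgebra_smallest (A : algebra) (G : set A) :
  is_subalgebra (smallest (@is_subalgebra A) G).
Proof.
move=> m f fA t tG B [Bsub GB]; apply: (Bsub m) => // i.
by apply: (tG i); split.
Qed.

(* A subalgebra is identified with its underlying set, since its operations   *)
(* are the restrictions of those of A.                                        *)
Record Subalg (A : algebra) := MkSubalg {
  subalg_set :> set A;
  _ : `[< is_subalgebra subalg_set >]
}.

HB.instance Definition _ (A : algebra) := [isSub for @subalg_set A].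
HB.instance Definition _ (A : algebra) := [Choice of Subalg A by <:].

Fact subalg_display : Order.disp_t. Proof. exact: Order.Disp tt tt. Qed.

Lemma Subalg_is_subalgebra (A : algebra) (X : Subalg A) : is_subalgebra X.
Proof. by case: X => B /= /asboolP. Qed.

Definition Subalg_le (A : algebra) (X Y : Subalg A) : bool := `[< X `<=` Y >].

Lemma Subalg_le_refl (A : algebra) : reflexive (@Subalg_le A).
Proof. by move=> X; apply/asboolP. Qed.

Lemma Subalg_le_anti (A : algebra) : antisymmetric (@Subalg_le A).
Proof.
by move=> X Y /andP[/asboolP XY /asboolP YX]; apply/val_inj/seteqP.
Qed.

Lemma Subalg_le_trans (A : algebra) : transitive (@Subalg_le A).
Proof.
by move=> Y X Z /asboolP XY /asboolP YZ; apply/asboolP/(subset_trans XY).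
Qed.

HB.instance Definition _ (A : algebra) :=
  Order.Le_isPOrder.Build subalg_display (Subalg A)
    (@Subalg_le_refl A) (@Subalg_le_anti A) (@Subalg_le_trans A).

Definition Subalg_meet (A : algebra) (X Y : Subalg A) : Subalg A :=
  MkSubalg (asboolT (is_subalgebraI (@Subalg_is_subalgebra A X)
                                 (@Subalg_is_subalgebra A Y))).

Definition Subalg_join (A : algebra) (X Y : Subalg A) : Subalg A :=
  MkSubalg (asboolT (@is_subalgebra_smallest A (X `|` Y))).

Lemma Subalg_meetP (A : algebra) (X Y Z : Subalg A) :
  (X <= Subalg_meet Y Z)%O = (X <= Y)%O && (X <= Z)%O.
Proof.
apply/asboolP/andP => [XYZ|[/asboolP XY /asboolP XZ] x Xx].
  by split; apply/asboolP => x Xx; have [] := XYZ x Xx.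
by split; [apply: XY | apply: XZ].
Qed.

Lemma Subalg_joinP (A : algebra) (X Y Z : Subalg A) :
  (Subalg_join X Y <= Z)%O = (X <= Z)%O && (Y <= Z)%O.
Proof.
apply/asboolP/andP => [XYZ|[/asboolP XZ /asboolP YZ]].
  have {}XYZ := subset_trans (@sub_gen_smallest _ _ (X `|` Y)) XYZ.
  by split; apply/asboolP => x xXY; apply: XYZ; [left | right].
by apply: smallest_sub; [exact: Subalg_is_subalgebra | rewrite subUset].
Qed.

HB.instance Definition _ (A : algebra) :=
  Order.POrder_MeetJoin_isLattice.Build subalg_display (Subalg A)
    (@Subalg_meetP A) (@Subalg_joinP A).

Definition lattice_isomorphic (d d' : Order.disp_t)
    (L : latticeType d) (L' : latticeType d') : Prop :=
  exists f : {lmorphism L -> L'}, bijective f.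

Definition is_algebraic_representation (A : algebra)
    (d : Order.disp_t) (L : latticeType d) : Prop :=
  lattice_isomorphic (Subalg A) L.

Definition is_chain_lattice (d : Order.disp_t) (L : latticeType d) (n : nat) :
    Prop :=
  total (<=%O : rel L) /\ [set: L] #= `I_n.

(* Main.v *)
From HB Require Import structures.
Require Import Defs.
From mathcomp Require Import all_boot all_order finmap.
From mathcomp Require Import boolp classical_sets functions cardinality.

Import Order.Theory.
Local Open Scope classical_set_scope.
Local Open Scope card_scope.

(** A chain with [n] elements represents itself.  Take the elements of [L] as
    carrier and, for every [a] other than the top, the operation sending [x] to
    the meet of [a] and [x]; for the bottom [a] this map is constant, and it is
    taken with arity 0.  The constant puts the bottom into every subalgebra, and
    the operation of [a] puts [a] into every subalgebra that has an element above
    [a], so that subalgebras are closed downwards; conversely, lower sets are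
    closed under these operations since the meet of [a] and [x] lies below [x].
    So the subalgebras are exactly the nonempty lower sets
    ([is_subalgebra_meet_algebra]).  In a finite chain such a set is determined
    by its greatest element, hence sending [a] to the set of all [x <= a] is an
    isomorphism from [L] to the lattice of subalgebras.  The operations are
    pairwise distinct because the one attached to [a] takes the value [a] at the
    top; as only the top is left out, there are [n - 1] of them.  The hypothesis
    [2 <= n] makes the bottom differ from the top, so that the constant is among
    the operations and the empty set is not a subalgebra. *)

Lemma card_setD1 {T : choiceType} (A : set T) (x : T) (n : nat) :
  A x -> A #= `I_n -> A `\ x #= `I_(n - 1).
Proof.
move=> + An; have /finite_fsetP[X XE] : finite_set A by exists n.
rewrite {}XE /= in An * => xX; rewrite -set_fsetD1.
move/card_eq_fsetP: An => <-; apply/card_eq_fsetP.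
by rewrite (cardfsD1 x X) xX addKn.
Qed.

(** Stated for an arbitrary total preorder, so that it yields least elements by
    passing to the converse relation. *)
Lemma finite_set_greatest {T : eqType} (r : rel T) (A : set T) :
  transitive r -> total r -> finite_set A -> A !=set0 ->
  exists2 a, A a & forall x, A x -> r x a.
Proof.
move=> r_trans r_tot /finite_seqP[s ->] [x0 /= x0s].
have r_refl : reflexive r by move=> x; have := r_tot x x; rewrite orbb.
suff [a as_ a_max]: exists2 a, a \in s & {in s, forall x, r x a} by exists a.
have : s != [::] by case: s x0s.
elim: s {x0 x0s} => // x [_ _|y s /(_ isT)[a as_ a_max] _].
  by exists x; rewrite ?mem_head// => z; rewrite !inE => /eqP->.
have /orP[xa|ax] := r_tot x a.
  by exists a => [|z]; rewrite in_cons ?as_ ?orbT// => /predU1P[->|/a_max].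
exists x => [|z]; rewrite ?mem_head// in_cons => /predU1P[->//|/a_max za].
exact: r_trans ax.
Qed.

(** An order isomorphism preserves meets and joins because these are determined
    by the order.  The map is given from [L'] to [L], the direction in which the
    principal lower sets are explicit. *)
Lemma lattice_isomorphic_order_iso {d d' : Order.disp_t} {L : latticeType d}
    {L' : latticeType d'} (g : L' -> L) :
  {mono g : x y / (x <= y)%O} -> (forall x, exists y, g y = x) ->
  lattice_isomorphic L L'.
Proof.
move=> g_mono /choice[f fK].
have gK : cancel g f.
  by move=> y; apply/le_anti; rewrite -!g_mono !fK lexx.
have f_le x y : (f x <= y)%O = (x <= g y)%O by rewrite -g_mono fK.
have le_f x y : (y <= f x)%O = (g y <= x)%O by rewrite -g_mono fK.
have f_homo : {homo f : x y / (x <= y)%O} by move=> x y xy; rewrite f_le fK.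
have f_meet : Order.meet_morphism f.
  move=> x y; apply/le_anti/andP; split.
    by rewrite lexI !f_homo ?leIl ?leIr.
  by rewrite le_f lexI -!le_f ?leIl ?leIr.
have f_join : Order.join_morphism f.
  move=> x y; apply/le_anti/andP; split.
    by rewrite f_le leUx -!f_le ?leUl ?leUr.
  by rewrite leUx !f_homo ?leUl ?leUr.
pose fO := Order.isOrderMorphism.Build d L d' L' f f_homo.
pose fM := Order.isMeetLatticeMorphism.Build d L d' L' f f_meet.
pose fJ := Order.isJoinLatticeMorphism.Build d L d' L' f f_join.
pose F : {lmorphism L -> L'} := HB.pack f fO fM fJ.
by exists F; exists g.
Qed.

(** The meet with the bottom is constant.  Taking it with arity 0 is what keeps
    the empty set from being a subalgebra. *)
Definition meet_operation {d : Order.disp_t} {L : latticeType d} (bot a : L) :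
    operation L :=
  if a == bot then existT (fun m => m.-tuple L -> L) 0 (fun=> bot)
  else existT (fun m => m.-tuple L -> L) 1 (fun t => (a `&` tnth t ord0)%O).

Definition meet_algebra {d : Order.disp_t} {L : latticeType d} (bot top : L) :
    algebra :=
  Algebra (meet_operation bot @` [set~ top]).

(** [a] is recovered from its operation by evaluating at the top, which is the
    neutral element of the meet. *)
Lemma meet_operation_inj {d : Order.disp_t} {L : latticeType d} (bot top : L) :
  (forall x, (x <= top)%O) -> injective (meet_operation bot).
Proof.
move=> le_top.
pose eval (o : operation L) := projT2 o (nseq_tuple _ top).
apply: (can_inj (g := eval)) => a; rewrite /eval /meet_operation.
have [->|_] //= := eqVneq a bot.
by rewrite (tnth_nth top)/=; apply: meet_l.
Qed.

(** If [x <= y], then [x] is the value at [y] of the operation of [x], so closure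
    under the operations amounts to closure downwards. *)
Lemma is_subalgebra_meet_algebra {d : Order.disp_t} {L : latticeType d}
    (bot top : L) (B : set L) :
  (forall x, (bot <= x)%O) -> (forall x, (x <= top)%O) -> bot != top ->
  is_subalgebra (A := meet_algebra bot top) B <->
  B bot /\ forall x y, (x <= y)%O -> B y -> B x.
Proof.
move=> bot_le le_top bot_top; split=> [Bsub|[Bbot Bdown] m f [a /= _ af]].
  have Bbot : B bot.
    apply: (Bsub 0 (fun=> bot) _ [tuple]); last by case.
    by exists bot; [exact/eqP | rewrite /meet_operation eqxx].
  split=> // x y xy By; have [->//|x_bot] := eqVneq x bot.
  have [xtop|x_top] := eqVneq x top.
    (* The top has no operation, but only the top itself lies above it. *)
    suff -> : x = y by [].
    by apply/le_anti; rewrite xy xtop le_top.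
  rewrite -(meet_l xy).
  apply: (Bsub 1 (fun t => Order.meet x (tnth t ord0)) _ [tuple y]).
    by exists x; [exact/eqP | rewrite /meet_operation (negPf x_bot)].
  by move=> i; rewrite ord1.
(* Closure is stated for a whole operation, so that the equation between
   dependent pairs can be rewritten without being split. *)
pose closed (o : operation L) :=
  forall t : (tag o).-tuple L, (forall i, B (tnth t i)) -> B (tagged o t).
suff : closed (meet_operation bot a) by rewrite af.
rewrite /meet_operation; case: ifP => _ t Bt //=.
exact: Bdown (leIr _ _) (Bt ord0).
Qed.

(** The sets of all [x <= a] are included in each other exactly as the elements
    [a] are ordered, and a nonempty lower set of a finite chain is of this form,
    with [a] its greatest element. *)
Lemma meet_algebra_representation {d : Order.disp_t} {L : latticeType d}
    (bot top : L) :
  total (<=%O : rel L) -> finite_set [set: L] ->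
  (forall x, (bot <= x)%O) -> (forall x, (x <= top)%O) -> bot != top ->
  is_algebraic_representation (meet_algebra bot top) L.
Proof.
move=> L_total L_fin bot_le le_top bot_top.
have subP B := is_subalgebra_meet_algebra bot top B bot_le le_top bot_top.
have lower_sub a :
    is_subalgebra (A := meet_algebra bot top) [set x : L | (x <= a)%O].
  by apply/subP; split=> [|x y xy]; [exact: bot_le | exact: le_trans].
pose lower a : Subalg (meet_algebra bot top) := MkSubalg (asboolT (lower_sub a)).
apply: (lattice_isomorphic_order_iso lower) => [a b|X].
  apply/asboolP/idP => [|ab x]; first by apply; exact: lexx.
  by move=> xa; exact: le_trans ab.
have /subP[Xbot Xdown] := @Subalg_is_subalgebra _ X.
have X_fin : finite_set (subalg_set X) by exact: sub_finite_set L_fin.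
have [a Xa a_max] := finite_set_greatest (<=%O : rel L) (subalg_set X)
  le_trans L_total X_fin (ex_intro _ bot Xbot).
exists a; apply/val_inj/seteqP; split=> x; last exact: a_max.
by move=> xa; exact: Xdown xa Xa.
Qed.

Theorem proposition1 (n : nat) (d : Order.disp_t) (L : latticeType d) :
  2 <= n ->
  is_chain_lattice L n ->
  exists A : algebra,
    [/\ is_algebraic_representation A L,
        [set: carrier A] #= `I_n &
        ops A #= `I_(n - 1)].
Proof.
move=> n2 [L_total Ln].
have L_fin : finite_set [set: L] by exists n.
have L_neq0 : [set: L] !=set0.
  apply/set0P; rewrite -(card_eq0 (U := nat)) (card_eql Ln) card_eq0.
  by apply/set0P; exists 0; exact: ltnW.
have [top _ /(_ _ I) le_top] := finite_set_greatest (<=%O : rel L) setT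
  le_trans L_total L_fin L_neq0.
have [bot _ /(_ _ I) bot_le] := finite_set_greatest (>=%O : rel L) setT
  (fun y x z xy yz => le_trans yz xy) (fun x y => L_total y x) L_fin L_neq0.
have bot_top : bot != top.
  apply/eqP => bt; have L1 : [set: L] = [set top].
    apply/seteqP; split=> // x _; apply/le_anti.
    by apply/andP; split; [exact: le_top | rewrite -bt; exact: bot_le].
  move: Ln; rewrite L1 (card_eql card_set1) => /card_eq_II n1.
  by rewrite -n1 in n2.
exists (meet_algebra bot top); split=> //.
  exact: meet_algebra_representation.
apply: card_eq_trans (card_setD1 setT top n I Ln).
rewrite setTD; apply: inj_card_eq => a b _ _.
exact: meet_operation_inj le_top a b.
Qed.
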